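(* Consider the primal problem (P), its dual (D), and the inexact augmented Lagrangian method (Algorithm 1) defined in the context. Let $\{(z^k,x^k)\}$, $z^k=(u^k,v^k,w^k)$, be a sequence generated by Algorithm 1 under stopping criterion (B): $\Theta_k(z^{k+1})-\inf\Theta_k\le\zeta_k^2\|x^{k+1}-x^k\|^2/(2\sigma_k)$ for all $k\ge0$, where $\zeta_k\ge0$ and $\sum_{k=0}^\infty\zeta_k<\infty$, and let $x^k\to x^\infty\in\mathcal{T}_\phi^{-1}(0)$. Suppose that $\mathcal{T}_\phi$ is metrically subregular at $x^\infty$ for $0$ with modulus $\kappa_\phi$. Then, for all sufficiently large $k$, $$\mathrm{dist}(x^{k+1},\mathcal{T}_\phi^{-1}(0))\le\rho_k\,\mathrm{dist}(x^k,\mathcal{T}_\phi^{-1}(0)),$$ $$\|A^Tu^{k+1}-B^Tv^{k+1}+w^{k+1}\|\le\varsigma_k\,\mathrm{dist}(x^k,\mathcal{T}_\phi^{-1}(0)),$$ $$g(z^{k+1})-\inf g\le\varsigma_k'\,\mathrm{dist}(x^k,\mathcal{T}_\phi^{-1}(0)),$$ where $g$ is the objective function of (D), $\inf g$ is the optimal value of (D), and $$1>\rho_k=\Big(\kappa_\phi/\sqrt{\kappa_\phi^2+\sigma_k^2}+2\zeta_k\Big)(1-\zeta_k)^{-1}\ \to\ \rho_\infty=\kappa_\phi/\sqrt{\kappa_\phi^2+\sigma_\infty^2}\quad(\rho_\infty=0\text{ if }\sigma_\infty=\infty),$$ $$\varsigma_k=\sigma_k^{-1}(1-\zeta_k)^{-1}\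 \to\ \varsigma_\infty=1/\sigma_\infty\quad(\varsigma_\infty=0\text{ if }\sigma_\infty=\infty),$$ $$\varsigma_k'=\varsigma_k\big(\zeta_k^2\|x^{k+1}-x^k\|+\|x^{k+1}\|+\|x^k\|\big)/2\ \to\ \varsigma_\infty'=\|x^\infty\|/\sigma_\infty\quad(\varsigma_\infty'=0\text{ if }\sigma_\infty=\infty).$$
   Context: Let $A\in\mathbb{R}^{m\times n}$, $B\in\mathbb{R}^{s\times n}$, $d\in\mathbb{R}^s$; let $h:\mathbb{R}^m\to(-\infty,+\infty]$ be a closed proper convex function that is continuously differentiable on $\mathrm{dom}(h)$ and $p:\mathbb{R}^n\to(-\infty,+\infty]$ a closed proper convex function. (P): $\min_{x\in\mathbb{R}^n}\{f(x)=h(Ax)+p(x)\}$ subject to $Bx=d$. (D): $\min_{u,v,w}\{g(z):=h^*(u)-\langle v,d\rangle+p^*(w)\}$ subject to $A^Tu-B^Tv+w=0$, where $z=(u,v,w)\in\mathcal{Z}=\mathbb{R}^m\times\mathbb{R}^s\times\mathbb{R}^n$ and $h^*,p^*$ are convex conjugates. Lagrangian of (D): $l(u,v,w;x)=h^*(u)-\langle v,d\rangle+p^*(w)-\langle x,A^Tu-B^Tv+w\rangle$. Put $\phi(x)=\inf_{z\in\mathcal{Z}}l(z;x)$ (concave) and $\mathcal{T}_\phi(x)=\partial\phi(x)$ (concave subdifferential); $\mathcal{T}_\phi^{-1}(0)$ is the solution set of (P). The augmented Lagrangian is $\mathcal{L}_\sigma(u,v,w;x)=l(u,v,w;x)+\frac{\sigma}{2}\|A^Tu-B^Tv+w\|^2$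 for $\sigma>0$. Algorithm 1 (inexact ALM for (D)): start from $u^0,v^0,w^0,x^0$ and $\sigma_0>0$. For $k=0,1,\dots$: with $\Theta_k(z):=\mathcal{L}_{\sigma_k}(u,v,w;x^k)$ for $z=(u,v,w)$, compute $z^{k+1}=(u^{k+1},v^{k+1},w^{k+1})$ an approximate minimizer of $\Theta_k$ (in the sense of the stopping criterion); set $x^{k+1}=x^k-\sigma_k(A^Tu^{k+1}-B^Tv^{k+1}+w^{k+1})$; update $\sigma_{k+1}\ge\sigma_k$ so that $\sigma_k\uparrow\sigma_\infty\le\infty$. A multi-valued mapping $F:\mathcal{X}\rightrightarrows\mathcal{Y}$ is metrically subregular at $\bar x$ for $\bar y\in F(\bar x)$ with modulus $\kappa\ge0$ if there exist neighborhoods $\mathcal{E}_1$ of $\bar x$ and $\mathcal{E}_2$ of $\bar y$ such that $\mathrm{dist}(x,F^{-1}(\bar y))\le\kappa\,\mathrm{dist}(\bar y,F(x)\cap\mathcal{E}_2)$ for all $x\in\mathcal{E}_1$ (the distance to the empty set being $+\infty$). *)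

(* Defs.v *)
From mathcomp Require Import all_boot all_order all_algebra.
From mathcomp Require Import all_classical all_reals all_analysis.

Set Implicit Arguments.
Unset Strict Implicit.
Unset Printing Implicit Defensive.

Import Order.TTheory GRing.Theory Num.Theory.
Import numFieldNormedType.Exports.

Local Open Scope classical_set_scope.
Local Open Scope ring_scope.

Section euclidean.
Context {R : realType} {n : nat}.
Implicit Types (x y : 'cV[R]_n) (S : set 'cV[R]_n).

Definition dotv x y : R := \sum_(i < n) x i 0 * y i 0.

(* The library norm on matrices is the max norm; it induces the same topology. *)
Definition enorm x : R := Num.sqrt (dotv x x).

(* Equal to +oo when S is empty. *)
Definition dist x S : \bar R := ereal_inf [set (enorm (x - y))%:E | y in S].

End euclidean.

Section convex_analysis.
Context {R : realType} {n : nat}.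
Implicit Types f phi : 'cV[R]_n -> \bar R.
Local Open Scope ereal_scope.

Definition edom f : set 'cV[R]_n := [set x | f x < +oo].

Definition proper_fun f := (forall x, -oo < f x) /\ (exists x, f x < +oo).

(* Meant for functions that do not take the value -oo, so that the right-hand
   side contains no oo - oo; note that 0 * +oo = 0. *)
Definition convex_fun f := forall (x y : 'cV[R]_n) (t : R), (0 <= t <= 1)%R ->
  f (t *: x + (1 - t) *: y)%R <= t%:E * f x + (1 - t)%:E * f y.

(* For proper functions, closed means lower semicontinuous. *)
Definition closed_proper_convex f :=
  [/\ lower_semicontinuous f, proper_fun f & convex_fun f].

(* The domain is not assumed to be open: the first-order expansion at x and
   the continuity of the gradient are taken relative to the domain. At interior
   points of the domain G is the usual gradient. *)
Definition continuously_differentiable_on_dom f :=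
  exists G : 'cV[R]_n -> 'cV[R]_n,
    {within edom f, continuous G} /\
    forall x, edom f x -> forall eps : R, (0 < eps)%R ->
      \forall y \near within (edom f) (nbhs x),
        (`|fine (f y) - fine (f x) - dotv (G x) (y - x)|
           <= eps * enorm (y - x))%R.

Definition conjugate f (u : 'cV[R]_n) : \bar R :=
  ereal_sup [set (dotv u x)%:E - f x | x in setT].

(* The subdifferential is empty at points where the function is not finite. *)
Definition concave_subdifferential phi (x : 'cV[R]_n) : set 'cV[R]_n :=
  [set y | phi x \is a fin_num /\
           forall x', phi x' <= phi x + (dotv y (x' - x)%R)%:E].

End convex_analysis.

Section multivalued.
Context {R : realType} {n q : nat}.
Implicit Type F : 'cV[R]_n -> set 'cV[R]_q.

Definition inverse_image F (y : 'cV[R]_q) : set 'cV[R]_n := [set x | F x y].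

(* When F x `&` E2 is empty the right-hand side is meant to be +oo, also for
   kappa = 0; as 0 * +oo = 0 in the library, that case is excluded explicitly. *)
Definition metrically_subregular F (xbar : 'cV[R]_n) (ybar : 'cV[R]_q)
    (kappa : R) :=
  [/\ 0 <= kappa, F xbar ybar &
    exists E1 E2, [/\ nbhs xbar E1, nbhs ybar E2 &
      forall x, E1 x -> F x `&` E2 !=set0 ->
        (dist x (inverse_image F ybar)
           <= kappa%:E * dist ybar (F x `&` E2))%E]].

End multivalued.

Section problem.
Context {R : realType} {m n s : nat}.
Variables (A : 'M[R]_(m, n)) (B : 'M[R]_(s, n)) (d : 'cV[R]_s).
Variables (h : 'cV[R]_m -> \bar R) (p : 'cV[R]_n -> \bar R).

Definition dual_space : Type := 'cV[R]_m * 'cV[R]_s * 'cV[R]_n.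
Implicit Types (z : dual_space) (x : 'cV[R]_n) (sigma : R).

Definition dual_residual z : 'cV[R]_n :=
  let: (u, v, w) := z in A^T *m u - B^T *m v + w.

Local Open Scope ereal_scope.

Definition dual_obj z : \bar R :=
  let: (u, v, w) := z in conjugate h u - (dotv v d)%:E + conjugate p w.

Definition dual_value : \bar R :=
  ereal_inf [set dual_obj z | z in [set z | dual_residual z = 0%R]].

Definition lagrangian z x : \bar R :=
  dual_obj z - (dotv x (dual_residual z))%:E.

Definition phi x : \bar R := ereal_inf [set lagrangian z x | z in setT].

Definition T_phi : 'cV[R]_n -> set 'cV[R]_n := concave_subdifferential phi.

Definition augmented_lagrangian sigma z x : \bar R :=
  lagrangian z x + (sigma / 2 * enorm (dual_residual z) ^+ 2)%:E.

(* The scheme of the inexact augmented Lagrangian method, apart from the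
   criterion that z k.+1 has to meet; sigma_oo may be +oo. *)
Definition alm_sequence (z : nat -> dual_space) (x : nat -> 'cV[R]_n)
    (sigma : nat -> R) (sigma_oo : \bar R) :=
  [/\ (0 < sigma 0)%R,
      (forall k, sigma k <= sigma k.+1)%R,
      (sigma k)%:E @[k --> \oo] --> sigma_oo &
      forall k, (x k.+1 = x k - sigma k *: dual_residual (z k.+1))%R].

(* The subtraction in \bar R is harmless: the conjugates of h and p are proper,
   hence the infimum is not +oo and Theta never takes the value -oo. *)
Definition stopping_criterion_B (z : nat -> dual_space) (x : nat -> 'cV[R]_n)
    (sigma zeta : nat -> R) :=
  [/\ (forall k, 0 <= zeta k)%R,
      \sum_(0 <= k <oo) (zeta k)%:E < +oo &
      forall k, let Theta z' := augmented_lagrangian (sigma k) z' (x k) in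
        Theta (z k.+1) - ereal_inf [set Theta z' | z' in setT]
          <= (zeta k ^+ 2 * enorm (x k.+1 - x k) ^+ 2 / (2 * sigma k))%:E].

End problem.

(* Main.v *)
Require Import Defs.
From mathcomp Require Import all_boot all_order all_algebra.
From mathcomp Require Import all_classical all_reals all_analysis.
From mathcomp Require Import ring lra.

(** The method is an inexact proximal point method in the variable x, and the
proof follows one of its steps. Write g for the dual objective and r(z) for the
residual A^T u - B^T v + w, so that phi x = inf_z (g z - <x, r z>).

Minimizing Theta_k exactly amounts to a proximal step for phi. Along a
minimizing sequence of Theta_k the residuals form a Cauchy sequence, because the
quadratic term makes Theta_k strongly convex in r. Let rbar be their limit.
Then y = x^k - sigma_k rbar satisfies - rbar \in T_phi y, and Theta_k grows at
least like sigma_k / 2 * |r - rbar|^2 above its infimum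
([augmented_minimizer], [proximal_point]). The infimum of Theta_k need not be
attained; the limit of the residuals takes the place of a minimizer.

By the quadratic growth, criterion (B) gives
|x^{k+1} - y| <= zeta_k |x^{k+1} - x^k|; since also inf Theta_k <= inf g, it
bounds the gap in the dual objective ([inexact_step]).

Monotonicity of T_phi between y and a solution gives
|x^k - y|^2 + |y - xhat|^2 <= |x^k - xhat|^2 ([proximal_pythagoras]). So y stays
near x_oo, rbar is small, and metric subregularity applies at y:
dist(y, Sol) <= kappa |rbar| = kappa / sigma_k * |x^k - y|. Together with the
Pythagorean inequality this yields the factor
kappa / sqrt(kappa^2 + sigma_k^2); the error |x^{k+1} - y| accounts for the terms
in zeta_k ([contraction_estimates]). *)

Import Order.TTheory GRing.Theory Num.Theory.
Import numFieldNormedType.Exports.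

Local Open Scope classical_set_scope.
Local Open Scope ring_scope.

Set Implicit Arguments.
Unset Strict Implicit.
Unset Printing Implicit Defensive.

(** * Euclidean geometry of column vectors *)

Section euclidean_geometry.
Context {R : realType} {n : nat}.
Implicit Types (x y r q : 'cV[R]_n) (t : R) (S : set 'cV[R]_n).

Lemma dotvC x y : dotv x y = dotv y x.
Proof. by apply: eq_bigr => i _; rewrite mulrC. Qed.

Lemma dotvDl x y r : dotv (x + y) r = dotv x r + dotv y r.
Proof. by rewrite -big_split; apply: eq_bigr => i _; rewrite mxE mulrDl. Qed.

Lemma dotvZl t x r : dotv (t *: x) r = t * dotv x r.
Proof. by rewrite mulr_sumr; apply: eq_bigr => i _; rewrite mxE mulrA. Qed.

Lemma dotvNl x r : dotv (- x) r = - dotv x r.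
Proof. by rewrite -scaleN1r dotvZl mulN1r. Qed.

Lemma dotvDr x y r : dotv r (x + y) = dotv r x + dotv r y.
Proof. by rewrite dotvC dotvDl !(dotvC r). Qed.

Lemma dotvZr t x r : dotv r (t *: x) = t * dotv r x.
Proof. by rewrite dotvC dotvZl dotvC. Qed.

Lemma dotvNr x r : dotv r (- x) = - dotv r x.
Proof. by rewrite dotvC dotvNl dotvC. Qed.

Definition dotvE := (dotvDl, dotvDr, dotvNl, dotvNr, dotvZl, dotvZr).

Lemma dotv0 x : dotv x 0 = 0.
Proof. by rewrite /dotv big1// => i _; rewrite mxE mulr0. Qed.

Lemma dotv_ge0 x : 0 <= dotv x x.
Proof. by apply: sumr_ge0 => i _; rewrite -expr2 sqr_ge0. Qed.

Lemma sqr_enorm x : enorm x ^+ 2 = dotv x x.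
Proof. by rewrite /enorm sqr_sqrtr// dotv_ge0. Qed.

Lemma enorm_ge0 x : 0 <= enorm x.
Proof. exact: sqrtr_ge0. Qed.
#[local] Hint Resolve enorm_ge0 : core.

Lemma enormN x : enorm (- x) = enorm x.
Proof. by rewrite /enorm !dotvE opprK. Qed.

Lemma enorm_distC x y : enorm (x - y) = enorm (y - x).
Proof. by rewrite -enormN opprB. Qed.

Lemma enormZ t x : 0 <= t -> enorm (t *: x) = t * enorm x.
Proof.
move=> t0; rewrite /enorm !dotvE mulrA -expr2 sqrtrM ?sqr_ge0//.
by rewrite sqrtr_sqr ger0_norm.
Qed.

Lemma enorm0 : enorm (0 : 'cV[R]_n) = 0.
Proof. by rewrite /enorm dotv0 sqrtr0. Qed.

Lemma normr_coord_le x i : `|x i 0| <= enorm x.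
Proof.
rewrite -sqrtr_sqr ler_wsqrtr// /dotv (bigD1 i)//= expr2 lerDl.
by apply: sumr_ge0 => j _; rewrite -expr2 sqr_ge0.
Qed.

Lemma enorm_eq0 x : enorm x = 0 -> x = 0.
Proof.
move=> x0; apply/colP => i; apply/eqP; rewrite mxE -normr_le0 -x0.
exact: normr_coord_le.
Qed.

Lemma cauchy_schwarz x y : dotv x y <= enorm x * enorm y.
Proof.
have [x0|x0] := eqVneq (enorm x) 0.
  by rewrite (enorm_eq0 x0) dotvC dotv0 -(enorm_eq0 x0) x0 mul0r.
have [y0|y0] := eqVneq (enorm y) 0.
  by rewrite (enorm_eq0 y0) dotv0 -(enorm_eq0 y0) y0 mulr0.
have xy_gt0 : 0 < enorm x * enorm y by rewrite mulr_gt0// lt0r ?x0 ?y0/=.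
(* Expanding the square gives 2 |x| |y| (|x| |y| - <x, y>) >= 0. *)
have := dotv_ge0 (enorm y *: x - enorm x *: y).
rewrite !dotvE -!sqr_enorm (dotvC y x) => h.
rewrite -subr_ge0 -(pmulr_rge0 _ xy_gt0); nra.
Qed.

Lemma ler_enormD x y : enorm (x + y) <= enorm x + enorm y.
Proof.
rewrite -(@ler_pXn2r _ 2)// ?nnegrE ?addr_ge0//.
rewrite sqr_enorm !dotvE -!sqr_enorm (dotvC y x).
by have := cauchy_schwarz x y; nra.
Qed.

Lemma ler_distB_enorm x y : enorm x - enorm y <= enorm (x - y).
Proof. by rewrite lerBlDr -{1}(subrK y x) ler_enormD. Qed.

Lemma dotv_convex r q t :
  dotv (t *: r + (1 - t) *: q) (t *: r + (1 - t) *: q) =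
  t * dotv r r + (1 - t) * dotv q q - t * (1 - t) * dotv (r - q) (r - q).
Proof. rewrite !dotvE (dotvC q r); ring. Qed.

End euclidean_geometry.
#[local] Hint Resolve enorm_ge0 : core.

(** * Convergence in the Euclidean norm *)

Section euclidean_topology.
Context {R : realType} {n : nat}.
Implicit Types (x y : 'cV[R]_n) (S : set 'cV[R]_n).

Lemma cvg_dotv {T : Type} {F : set_system T} {FF : Filter F}
    (f g : T -> 'cV[R]_n) x y :
  f t @[t --> F] --> x -> g t @[t --> F] --> y ->
  dotv (f t) (g t) @[t --> F] --> dotv x y.
Proof.
move=> fx gy; apply: cvg_big => [|i _]; first exact: add_continuous.
have cv (h : T -> 'cV[R]_n) (z : 'cV[R]_n) :
    h t @[t --> F] --> z -> h t i 0 @[t --> F] --> z i 0.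
  by move=> hz; exact: (cvg_comp _ _ hz (@coord_continuous _ _ _ i 0 z)).
exact: cvgM (cv _ _ fx) (cv _ _ gy).
Qed.

Lemma cvg_enorm {T : Type} {F : set_system T} {FF : Filter F}
    (f : T -> 'cV[R]_n) x :
  f t @[t --> F] --> x -> enorm (f t) @[t --> F] --> enorm x.
Proof.
by move=> fx; exact: (cvg_comp _ _ (cvg_dotv fx fx) (@sqrt_continuous _ _)).
Qed.

(** The topology on matrices comes from the max norm, which the Euclidean norm
    dominates. *)
Lemma near_enorm x S : nbhs x S ->
  exists2 e : R, 0 < e & forall y, enorm (y - x) < e -> S y.
Proof.
move=> /nbhs_ballP[e /= e0 eS]; exists e => // y yx; apply: eS; split=> // i j.
rewrite (ord1 j) -ball_normE/= distrC; apply: le_lt_trans yx.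
by have := normr_coord_le (y - x) i; rewrite !mxE.
Qed.

(** A Cauchy criterion in the form in which minimizing sequences of strongly
    convex functions meet it: e k is the excess over the infimum. *)
Lemma enorm_complete (r : nat -> 'cV[R]_n) (e : nat -> R) :
  e k @[k --> \oo] --> 0 ->
  (forall i j, dotv (r i - r j) (r i - r j) <= e i + e j) ->
  exists l : 'cV[R]_n, r k @[k --> \oo] --> l.
Proof.
move=> e0 re; suff /cauchy_cvgP/cvg_ex : cauchy (r k @[k --> \oo]) by [].
apply/cauchy_ballP => eps eps0; near_simpl.
have esmall : \forall k \near \oo, e k < eps ^+ 2 / 2.
  by apply: (cvgr_lt 0) => //; rewrite divr_gt0// exprn_gt0.
have {}esmall := esmall.
near=> i j => /=; split=> // a b; rewrite (ord1 b) -ball_normE/=.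
have ei : e i < eps ^+ 2 / 2 by near: i.
have ej : e j < eps ^+ 2 / 2 by near: j.
have := normr_coord_le (r i - r j) a; rewrite !mxE => /le_lt_trans; apply.
rewrite -(@ltr_pXn2r _ 2) ?nnegrE ?enorm_ge0 ?(ltW eps0)// sqr_enorm.
by apply: le_lt_trans (re i j) _; lra.
Unshelve. all: by end_near. Qed.

(** Replaces a distance in \bar R by a real number with the two properties of an
    infimum; this is how distances are compared below. *)
Lemma dist_finE x S : S !=set0 -> exists2 D : R, dist x S = D%:E &
  (forall y, S y -> D <= enorm (x - y)) /\
  (forall c, (forall y, S y -> c <= enorm (x - y)) -> c <= D).
Proof.
move=> [y0 Sy0].
have ge0 : (0%:E <= dist x S)%E.
  by apply: le_ereal_inf_tmp => _ [y Sy <-]; rewrite lee_fin enorm_ge0.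
have fin : dist x S \is a fin_num.
  rewrite ge0_fin_numE//; apply: le_lt_trans (ltry (enorm (x - y0))).
  by apply: ereal_inf_lbound; exists y0.
exists (fine (dist x S)); first by rewrite fineK.
split=> [y Sy|c cle].
  by rewrite -lee_fin fineK//; apply: ereal_inf_lbound; exists y.
rewrite -lee_fin fineK//; apply: le_ereal_inf_tmp => _ [y Sy <-].
by rewrite lee_fin cle.
Qed.

End euclidean_topology.

(** * Strongly convex minimization and the proximal point *)

Section proximal_point.
Context {R : realType} {n : nat}.
Implicit Types (C : R -> 'cV[R]_n -> Prop) (x r : 'cV[R]_n).

(** C stands for the set of pairs (g z, residual z) with g z finite. Convexity of g
    only bounds its value at a convex combination from above, whence the
    inequality on the first component. *)
Definition up_convex C := forall a r b q t, C a r -> C b q -> 0 <= t <= 1 ->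
  exists2 c, C c (t *: r + (1 - t) *: q) & c <= t * a + (1 - t) * b.

(** The infimum M of V need not be attained on C, but the r-components of a
    minimizing sequence converge, since V is strongly convex in r; rbar is their
    limit. The first conclusion is quadratic growth of V away from rbar, the third
    evaluates a Lagrangian lower bound along the sequence. With phi x' the best
    constant c, the first says phi (x - sigma *: rbar) >= M + sigma / 2 |rbar|^2 and
    the third provides the supergradient - rbar there. *)
Lemma augmented_minimizer C x x0 (sigma c0 : R)
    (V := fun a r => a - dotv x r + sigma / 2 * dotv r r) :
  0 < sigma -> (exists a r, C a r) -> up_convex C ->
  (forall a r, C a r -> c0 <= a - dotv x0 r) ->
  exists rbar M, [/\
    forall a r, C a r -> M + sigma / 2 * dotv (r - rbar) (r - rbar) <= V a r,
    forall L, (forall a r, C a r -> L <= V a r) -> L <= M &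
    forall x' c, (forall a r, C a r -> c <= a - dotv x' r) ->
      c <= M - sigma / 2 * dotv rbar rbar - dotv (x' - x) rbar].
Proof.
move=> s0 [a0 [r0 C0]] Cconv lb.
set E := [set v | exists a r, C a r /\ v = V a r].
have E0 : E !=set0 by exists (V a0 r0), a0, r0.
(* The bound at x0 controls V, as the quadratic term absorbs <x - x0, r>. *)
have Vlb a r : C a r -> c0 - dotv (x - x0) (x - x0) / (2 * sigma) <= V a r.
  move=> Car; have := lb _ _ Car.
  have := dotv_ge0 (sigma *: r - (x - x0)).
  rewrite /V !dotvE (dotvC x0 x) (dotvC r x) (dotvC r x0) => sq le.
  rewrite lerBlDr -(ler_pM2r s0) mulrDl.
  have -> : forall w : R, w / (2 * sigma) * sigma = w / 2.
    by move=> w; field; rewrite gt_eqF.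
  nra.
have Elb : has_lbound E.
  by exists (c0 - dotv (x - x0) (x - x0) / (2 * sigma)) => _ [a [r [Car ->]]];
    exact: Vlb.
pose M := inf E.
have MV a r : C a r -> M <= V a r by move=> Car; apply: ge_inf => //; exists a, r.
have /choice[ar arP] : forall j : nat, exists p : R * 'cV[R]_n,
    C p.1 p.2 /\ V p.1 p.2 < M + harmonic j.
  move=> j; have [_ [a [r [Car ->]]] lt] := inf_adherent
    (harmonic_gt0 j : 0 < (harmonic j : R)) (conj E0 Elb).
  by exists (a, r).
pose a j := (ar j).1; pose r j := (ar j).2.
have Car j : C (a j) (r j) by have [] := arP j.
have Var j : V (a j) (r j) < M + harmonic j by have [] := arP j.
(* Strong convexity along the segment between two points of C. *)
have seg b q b' q' t : C b q -> C b' q' -> 0 <= t <= 1 ->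
    M <= t * V b q + (1 - t) * V b' q'
      - sigma / 2 * (t * (1 - t) * dotv (q - q') (q - q')).
  move=> Cb Cb' t01; have [c Cc cle] := Cconv _ _ _ _ _ Cb Cb' t01.
  have := MV _ _ Cc; rewrite /V dotv_convex (dotvDr _ _ x) !(dotvZr _ _ x) => h.
  apply: le_trans h _; lra.
have [rbar rcvg] : exists l : 'cV[R]_n, r k @[k --> \oo] --> l.
  apply: (@enorm_complete _ _ _ (fun k => 4 / sigma * harmonic k)).
    rewrite -[X in _ --> X](mulr0 (4 / sigma)).
    by apply: cvgMr; exact: cvg_harmonic.
  (* The midpoint has value at least M, hence the two points are close. *)
  move=> i j; have half : 0 <= (1 / 2 : R) <= 1 by lra.
  have := seg _ _ _ _ _ (Car i) (Car j) half.
  have := Var i; have := Var j => Vj Vi h.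
  rewrite -mulrDr mulrAC ler_pdivlMr//; nra.
have Vcvg : V (a k) (r k) @[k --> \oo] --> M.
  apply: (@squeeze_cvgr _ _ _ _ (fun=> M) (fun k => M + harmonic k)).
  - by near=> k; rewrite MV//= ltW.
  - exact: cvg_cst.
  - by rewrite -[X in _ --> X]addr0; apply: cvgD; [exact: cvg_cst|exact: cvg_harmonic].
exists rbar, M; split.
- move=> b q Cb.
  have diff : dotv (q - r k) (q - r k) @[k --> \oo] -->
      dotv (q - rbar) (q - rbar).
    by apply: cvg_dotv; apply: cvgB => //; exact: cvg_cst.
  (* Passing to the limit along the minimizing sequence and dividing by t; the
     growth estimate is the limit t -> 0, taken along t = harmonic k. *)
  have segt t : 0 < t <= 1 -> M <= V b q -
      (1 - t) * (sigma / 2 * dotv (q - rbar) (q - rbar)).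
    move=> /andP[t0 t1].
    rewrite -(ler_pM2l t0).
    have : M <= t * V b q + (1 - t) * M
        - sigma / 2 * (t * (1 - t) * dotv (q - rbar) (q - rbar)).
      apply: (@ler_cvg_to _ \oo _ _ (fun=> M) (fun k => t * V b q +
        (1 - t) * V (a k) (r k)
        - sigma / 2 * (t * (1 - t) * dotv (q - r k) (q - r k)))).
      + exact: cvg_cst.
      + apply: cvgB; last by do 2 apply: cvgMr.
        by apply: cvgD; [exact: cvg_cst|exact: cvgMr].
      + by near=> k; apply: seg => //; rewrite ltW.
    nra.
  rewrite -lerBrDr.
  have lim1 : V b q - (1 - harmonic k) * (sigma / 2 * dotv (q - rbar) (q - rbar))
      @[k --> \oo] --> V b q - sigma / 2 * dotv (q - rbar) (q - rbar).
    apply: cvgB; first exact: cvg_cst.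
    rewrite -[X in _ --> X]mul1r; apply: cvgMl.
    rewrite -[X in _ --> X]subr0; apply: cvgB; first exact: cvg_cst.
    exact: cvg_harmonic.
  apply: (@ler_cvg_to _ \oo _ _ (fun=> M) _ _ _ _ lim1); first exact: cvg_cst.
  near=> k; apply: segt; rewrite harmonic_gt0/=.
  by rewrite /harmonic/= invf_le1 ?ler1n.
- move=> L Lle; apply: lb_le_inf => // _ [b [q [Cb ->]]]; exact: Lle.
- move=> x' c cle.
  apply: (@ler_cvg_to _ \oo _ _ (fun=> c) (fun k => V (a k) (r k)
    - sigma / 2 * dotv (r k) (r k) - dotv (x' - x) (r k))).
  + exact: cvg_cst.
  + by apply: cvgB; [apply: cvgB => //; apply: cvgMr; exact: cvg_dotv|
      apply: cvg_dotv => //; exact: cvg_cst].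
  + near=> k; apply: le_trans (cle _ _ (Car k)) _.
    by rewrite /V dotvDl dotvNl; lra.
Unshelve. all: by end_near. Qed.

End proximal_point.

(** * The dual function and its proximal points *)

Section conjugate_convexity.
Context {R : realType} {n : nat}.
Implicit Types (f : 'cV[R]_n -> \bar R) (u : 'cV[R]_n).

Lemma conjugate_gtNy f u : proper_fun f -> (-oo < conjugate f u)%E.
Proof.
move=> [fNy [x fx]].
have : f x \is a fin_num by rewrite fin_numE gt_eqF ?fNy// lt_eqF.
case fxE : (f x) => [c| |]// _.
apply: lt_le_trans (ltNyr (dotv u x - c)) _.
by rewrite EFinB -fxE; apply: ereal_sup_ubound; exists x.
Qed.

Lemma conjugate_convex f u1 u2 (a1 a2 t : R) : proper_fun f -> 0 <= t <= 1 ->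
  conjugate f u1 = a1%:E -> conjugate f u2 = a2%:E ->
  (conjugate f (t *: u1 + (1 - t) *: u2) <= (t * a1 + (1 - t) * a2)%:E)%E.
Proof.
move=> [fNy _] /andP[t0 t1] c1 c2; apply: ge_ereal_sup => _ [x _ <-].
have affine_le u a : conjugate f u = a%:E -> ((dotv u x)%:E - f x <= a%:E)%E.
  by move=> <-; apply: ereal_sup_ubound; exists x.
have := fNy x; have := affine_le _ _ c1; have := affine_le _ _ c2.
case: (f x) => [c| |] /=; [|by move=> *; rewrite addeNy leNye|by rewrite ltxx].
rewrite -!EFinB !lee_fin dotvDl !dotvZl => l2 l1 _; nra.
Qed.

End conjugate_convexity.

Section concave_proximal.
Context {R : realType} {n : nat}.
Variable phi : 'cV[R]_n -> \bar R.
Implicit Types (x y q r : 'cV[R]_n).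

Local Notation T := (concave_subdifferential phi).

Lemma supergradient_toward_max xhat y q :
  T xhat 0 -> T y q -> 0 <= dotv q (xhat - y).
Proof.
move=> [finx Hx] [finy Hy]; have := Hx y; have := Hy xhat.
rewrite -(fineK finx) -(fineK finy) (dotvC 0) dotv0 -!EFinD !lee_fin; lra.
Qed.

(** A proximal step makes an obtuse angle with the direction to any maximizer;
    this sharpens the nonexpansiveness of the step. *)
Lemma proximal_pythagoras x r xhat (sigma : R) : 0 < sigma ->
  T xhat 0 -> T (x - sigma *: r) (- r) ->
  enorm (sigma *: r) ^+ 2 + enorm (x - sigma *: r - xhat) ^+ 2
    <= enorm (x - xhat) ^+ 2.
Proof.
move=> s0 Tx Ty; have := mulr_ge0 (ltW s0) (supergradient_toward_max Tx Ty).
rewrite !sqr_enorm !dotvE (dotvC r) (dotvC xhat) (dotvC r xhat) (dotvC r x).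
lra.
Qed.

End concave_proximal.

Lemma eq_fin_greatest (R : realType) (e : \bar R) (M : R) :
  (M%:E <= e)%E -> (forall L : R, (L%:E <= e)%E -> L <= M) -> e = M%:E.
Proof.
case: e => [e| |]//; rewrite ?lee_fin => Me.
  move=> /(_ e (lexx _)) eM; congr (_%:E); apply/eqP.
  by rewrite eq_le eM/= -lee_fin.
by move=> /(_ (M + 1)); rewrite leey gerDl ler10 => /(_ isT).
Qed.

Section dual_problem.
Context {R : realType} {m n s : nat}.
Variables (A : 'M[R]_(m, n)) (B : 'M[R]_(s, n)) (d : 'cV[R]_s).
Variables (h : 'cV[R]_m -> \bar R) (p : 'cV[R]_n -> \bar R).
Hypotheses (hprop : proper_fun h) (pprop : proper_fun p).
Implicit Types (z : @dual_space R m n s) (x y r : 'cV[R]_n) (sigma : R).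

Local Notation g := (dual_obj d h p).
Local Notation res := (dual_residual A B).
Local Notation phi := (phi A B d h p).
Local Notation Theta := (augmented_lagrangian A B d h p).
Local Notation T := (T_phi A B d h p).

Definition dual_pairs (a : R) r := exists z, g z = a%:E /\ res z = r.

Lemma dual_obj_gtNy z : (-oo < g z)%E.
Proof.
case: z => [[u v] w]; rewrite /dual_obj.
have := conjugate_gtNy u hprop; have := conjugate_gtNy w pprop.
by case: (conjugate h u) => [a| |]; case: (conjugate p w) => [b| |];
  rewrite ?ltxx//= ?ltNyr ?ltNyy.
Qed.

(** The constraint residual is linear and the dual objective is convex. *)
Lemma dual_pairs_convex : up_convex dual_pairs.
Proof.
move=> a1 r1 a2 r2 t [[[u1 v1] w1] [g1 <-]] [[[u2 v2] w2] [g2 <-]] t01.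
have fin u v w (a : R) : g (u, v, w) = a%:E -> exists b c,
    [/\ conjugate h u = b%:E, conjugate p w = c%:E & a = b - dotv v d + c].
  have := conjugate_gtNy u hprop; have := conjugate_gtNy w pprop; rewrite /dual_obj.
  case: (conjugate h u) => [b| |]//; case: (conjugate p w) => [c| |]// _ _ [<-].
  by exists b, c.
have [b1 [c1 [hb1 pc1 ->]]] := fin _ _ _ _ g1.
have [b2 [c2 [hb2 pc2 ->]]] := fin _ _ _ _ g2.
have hle := conjugate_convex hprop t01 hb1 hb2.
have ple := conjugate_convex pprop t01 pc1 pc2.
have := conjugate_gtNy (t *: u1 + (1 - t) *: u2) hprop.
have := conjugate_gtNy (t *: w1 + (1 - t) *: w2) pprop.
move: hle ple.
case hE : (conjugate h (t *: u1 + (1 - t) *: u2)) => [b| |]//.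
case pE : (conjugate p (t *: w1 + (1 - t) *: w2)) => [c| |]//.
rewrite !lee_fin => hle ple _ _.
exists (b - dotv (t *: v1 + (1 - t) *: v2) d + c).
  exists (t *: u1 + (1 - t) *: u2, t *: v1 + (1 - t) *: v2,
          t *: w1 + (1 - t) *: w2); split.
    by rewrite /dual_obj hE pE.
  rewrite /dual_residual !mulmxDr -!scalemxAr !scalerDr !scalerN opprD.
  by rewrite [RHS]addrACA; congr (_ + _); rewrite [RHS]addrACA.
rewrite dotvDl !dotvZl; nra.
Qed.

(** As the dual objective never takes the value -oo, phi and inf Theta only see the
    points where it is finite, that is dual_pairs. *)
Lemma le_phiP x (c : R) :
  (c%:E <= phi x)%E <-> forall a r, dual_pairs a r -> c <= a - dotv x r.
Proof.
split=> [cle a r [z [gz <-]]|cle].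
  rewrite -lee_fin EFinB -gz; apply: le_trans cle _.
  by apply: ereal_inf_lbound; exists z.
apply: le_ereal_inf_tmp => _ [z _ <-]; rewrite /lagrangian.
have := dual_obj_gtNy z; case gz : (g z) => [a| |]//= _; last by rewrite leey.
by rewrite -EFinB lee_fin cle//; exists z.
Qed.

Lemma le_inf_ThetaP sigma x (c : R) :
  (c%:E <= ereal_inf [set Theta sigma z x | z in setT])%E <->
  forall a r, dual_pairs a r -> c <= a - dotv x r + sigma / 2 * dotv r r.
Proof.
split=> [cle a r [z [gz <-]]|cle].
  rewrite -lee_fin EFinD EFinB -gz; apply: le_trans cle _.
  by apply: ereal_inf_lbound; exists z => //; rewrite -sqr_enorm.
apply: le_ereal_inf_tmp => _ [z _ <-]; rewrite /augmented_lagrangian /lagrangian.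
have := dual_obj_gtNy z; case gz : (g z) => [a| |]//= _; last by rewrite leey.
by rewrite -EFinB -EFinD lee_fin sqr_enorm cle//; exists z.
Qed.

(** The point x - sigma *: rbar is the proximal point of phi at x. Finiteness of phi
    at one point x0 makes the dual objective finite somewhere and bounds Theta
    from below. *)
Lemma proximal_point x x0 sigma : 0 < sigma -> phi x0 \is a fin_num ->
  exists rbar M, [/\
    T (x - sigma *: rbar) (- rbar),
    ereal_inf [set Theta sigma z x | z in setT] = M%:E &
    forall a r, dual_pairs a r -> M + sigma / 2 * dotv (r - rbar) (r - rbar)
      <= a - dotv x r + sigma / 2 * dotv r r].
Proof.
move=> s0 fin0.
have lb0 : forall a r, dual_pairs a r -> fine (phi x0) <= a - dotv x0 r.
  by apply/le_phiP; rewrite fineK.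
have ex : exists a r, dual_pairs a r.
  apply: contrapT => none.
  have : ((fine (phi x0) + 1)%:E <= phi x0)%E.
    by apply/le_phiP => a r ar; case: none; exists a, r.
  by rewrite -{2}(fineK fin0) lee_fin; lra.
have [rbar [M [growth infM supp]]] :=
  augmented_minimizer x s0 ex dual_pairs_convex lb0.
exists rbar, M; split=> //; last first.
  apply: eq_fin_greatest; last by move=> L /le_inf_ThetaP; exact: infM.
  apply/le_inf_ThetaP => a r ar; apply: le_trans (growth _ _ ar).
  by rewrite lerDl mulr_ge0 ?dotv_ge0 ?divr_ge0 ?ltW.
set y := x - sigma *: rbar.
have phiy : phi y = (M + sigma / 2 * dotv rbar rbar)%:E.
  apply: eq_fin_greatest.
    apply/le_phiP => a r ar; have := growth _ _ ar.
    rewrite /y !dotvE (dotvC rbar r); lra.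
  move=> L /le_phiP/supp; rewrite /y !dotvE; lra.
split; first by rewrite phiy.
move=> x'.
case E : (phi x') => [c| |]; [|exfalso|exact: leNye].
- rewrite phiy -EFinD lee_fin.
  have /le_phiP/supp : (c%:E <= phi x')%E by rewrite E.
  rewrite /y !dotvE (dotvC rbar x') (dotvC rbar x); lra.
- have /le_phiP/supp : ((M - sigma / 2 * dotv rbar rbar - dotv (x' - x) rbar + 1)%:E
      <= phi x')%E by rewrite E leey.
  lra.
Qed.

(** Here x' is the multiplier after an approximate minimization of Theta. Quadratic
    growth turns the error in Theta into the distance from x' to the proximal
    point. For the dual objective, g z' exceeds Theta z' by
    (|x|^2 - |x'|^2) / (2 sigma), and inf Theta is at most the dual value because
    Theta and g agree where the residual vanishes. *)
Lemma inexact_step x x' x0 z' sigma zeta : 0 < sigma -> 0 <= zeta ->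
  phi x0 \is a fin_num -> x' = x - sigma *: res z' ->
  (Theta sigma z' x - ereal_inf [set Theta sigma z x | z in setT]
     <= (zeta ^+ 2 * enorm (x' - x) ^+ 2 / (2 * sigma))%:E)%E ->
  (exists rbar, T (x - sigma *: rbar) (- rbar) /\
     enorm (x' - (x - sigma *: rbar)) <= zeta * enorm (x' - x)) /\
  (g z' - dual_value A B d h p <= (enorm (x' - x) / (2 * sigma)
     * (zeta ^+ 2 * enorm (x' - x) + enorm x' + enorm x))%:E)%E.
Proof.
move=> s0 zeta0 fin0 x'E crit.
have [rbar [M [Ty infM growth]]] := proximal_point x s0 fin0.
have [a gz'] : exists a, g z' = a%:E.
  move: crit; rewrite infM /augmented_lagrangian /lagrangian.
  have := dual_obj_gtNy z'; case: (g z') => [a _ _| |]; rewrite ?ltxx//.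
  by exists a.
have crit' : a - dotv x (res z') + sigma / 2 * dotv (res z') (res z') - M
    <= zeta ^+ 2 * dotv (x' - x) (x' - x) / (2 * sigma).
  move: crit; rewrite infM /augmented_lagrangian /lagrangian gz' !sqr_enorm.
  by rewrite -?EFinB -?EFinD -?EFinB lee_fin.
split.
  exists rbar; split=> //.
  rewrite -(@ler_pXn2r _ 2) ?nnegrE ?mulr_ge0 ?enorm_ge0// exprMn !sqr_enorm.
  have -> : x' - (x - sigma *: rbar) = (- sigma) *: (res z' - rbar).
    by rewrite x'E opprB addrC subrKA scaleNr scalerBr opprB.
  have := growth _ _ (ex_intro _ z' (conj gz' erefl)) => gr.
  have : sigma / 2 * dotv (res z' - rbar) (res z' - rbar)
      <= zeta ^+ 2 * dotv (x' - x) (x' - x) / (2 * sigma) by lra.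
  rewrite ler_pdivlMr ?mulr_gt0// dotvZl dotvZr; lra.
have le_value : (M%:E <= dual_value A B d h p)%E.
  apply: le_ereal_inf_tmp => _ [z rz0 <-]; have := dual_obj_gtNy z.
  case gz : (g z) => [b| |]; rewrite ?ltxx ?leey// => _; rewrite lee_fin.
  have := growth _ _ (ex_intro _ z (conj gz rz0)); rewrite !dotv0.
  have := dotv_ge0 (0 - rbar); nra.
have aM : a - M <= enorm (x' - x) / (2 * sigma)
     * (zeta ^+ 2 * enorm (x' - x) + enorm x' + enorm x).
  have s2 : 0 < 2 * sigma by rewrite mulr_gt0.
  rewrite mulrAC ler_pdivlMr//; move: crit'; rewrite ler_pdivlMr// -!sqr_enorm.
  have sq : enorm x' ^+ 2 = enorm x ^+ 2 - 2 * sigma * dotv x (res z')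
      + sigma ^+ 2 * enorm (res z') ^+ 2.
    by rewrite !sqr_enorm x'E !dotvE (dotvC (res z')); ring.
  have := ler_distB_enorm x x'; rewrite enorm_distC.
  have := enorm_ge0 x; have := enorm_ge0 x'; nra.
move: le_value; rewrite gz'; case: (dual_value _ _ _ _ _) => [v| |].
  3: by rewrite leeNy_eq.
  2: by rewrite addeNy leNye.
by rewrite -EFinB !lee_fin => Mv; apply: le_trans aM; rewrite lerD2l lerN2.
Qed.

End dual_problem.

(** * The rate and its limit *)

Section rate.
Context {R : realType} {n : nat}.
Implicit Types (x y : 'cV[R]_n) (S : set 'cV[R]_n).

(** Here y is the exact proximal point and x' the inexact one. Put e = |x - y|. The
    inequalities e^2 + dist(y)^2 <= dist(x)^2 and sigma dist(y) <= kappa e combine,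
    on eliminating e, to dist(y) <= kappa / sqrt(kappa^2 + sigma^2) dist(x); this
    form needs no case distinction when kappa = 0. *)
Lemma contraction_estimates x x' y S (sigma zeta kappa : R) :
  0 < sigma -> 0 <= zeta < 1 -> 0 <= kappa -> S !=set0 ->
  (forall xhat, S xhat ->
    enorm (x - y) ^+ 2 + enorm (y - xhat) ^+ 2 <= enorm (x - xhat) ^+ 2) ->
  (dist y S <= (kappa * (enorm (x - y) / sigma))%:E)%E ->
  enorm (x' - y) <= zeta * enorm (x' - x) ->
  ((enorm (x' - x))%:E <= ((1 - zeta)^-1)%:E * dist x S)%E /\
  (dist x' S <= ((kappa / Num.sqrt (kappa ^+ 2 + sigma ^+ 2) + 2 * zeta)
     * (1 - zeta)^-1)%:E * dist x S)%E.
Proof.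
move=> s0 /andP[z0 z1] k0 S0 pyth subreg inexact.
have [D -> [Dle leD]] := dist_finE x S0.
have [Dy DyE [Dyle leDy]] := dist_finE y S0.
have [D' -> [D'le leD']] := dist_finE x' S0.
move: subreg; rewrite DyE -!EFinM !lee_fin => subreg.
set e := enorm (x - y) in pyth subreg *.
have e0 : 0 <= e by exact: enorm_ge0.
have Dy0 : 0 <= Dy by apply: leDy => q _; exact: enorm_ge0.
have pythD : e ^+ 2 + Dy ^+ 2 <= D ^+ 2.
  rewrite -[leLHS]sqr_sqrtr ?addr_ge0 ?sqr_ge0//.
  rewrite ler_pXn2r ?nnegrE ?sqrtr_ge0//; last by apply: leD => q _; exact: enorm_ge0.
  apply: leD => q Sq; rewrite -[leRHS]ger0_norm ?enorm_ge0// -sqrtr_sqr ler_wsqrtr//.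
  apply: le_trans (pyth _ Sq); rewrite lerD2l ler_pXn2r ?nnegrE ?enorm_ge0//.
  exact: Dyle.
have D0 : 0 <= D by apply: leD => q _; exact: enorm_ge0.
have eD : e <= D by rewrite -(@ler_pXn2r _ 2)// ?nnegrE//; nra.
have step : enorm (x' - x) <= (1 - zeta)^-1 * D.
  rewrite ler_pdivlMl ?subr_gt0//.
  have : enorm (x' - x) <= enorm (x' - y) + e.
    have := ler_enormD (x' - y) (y - x); rewrite addrA subrK.
    by rewrite (enorm_distC y x).
  lra.
split=> //.
set w := Num.sqrt _.
have w2 : w ^+ 2 = kappa ^+ 2 + sigma ^+ 2.
  by rewrite sqr_sqrtr ?addr_ge0 ?sqr_ge0.
have w0 : 0 < w by rewrite sqrtr_gt0 ltr_wpDl ?sqr_ge0 ?exprn_gt0.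
have Dyw : Dy <= kappa / w * D.
  rewrite mulrAC ler_pdivlMr// -(@ler_pXn2r _ 2) ?nnegrE ?mulr_ge0 ?(ltW w0)//.
  rewrite !exprMn w2.
  have Dye : Dy * sigma <= kappa * e by rewrite -ler_pdivlMr// -mulrA.
  have : (Dy * sigma) ^+ 2 <= (kappa * e) ^+ 2.
    by rewrite ler_pXn2r ?nnegrE ?mulr_ge0 ?(ltW s0).
  rewrite !exprMn => Dye2.
  have := ler_wpM2l (sqr_ge0 kappa) pythD; lra.
have D'D : D' <= Dy + zeta * enorm (x' - x).
  rewrite -lerBlDr; apply: leDy => q Sq; rewrite lerBlDr.
  apply: le_trans (D'le _ Sq) _.
  have := ler_enormD (x' - y) (y - q); rewrite addrA subrK; lra.
have th0 : 0 <= kappa / w by rewrite divr_ge0// ltW.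
have := ler_wpM2l z0 step => step'.
set th := kappa / w in Dyw th0 *.
(* With D = dist(x), dist(x') <= (th + zeta / (1 - zeta)) D, and
   th (1 - zeta) + zeta <= th + 2 zeta. *)
rewrite mulrAC ler_pdivlMr ?subr_gt0//.
have step2 : (1 - zeta) * enorm (x' - x) <= D by rewrite -ler_pdivlMl ?subr_gt0.
nra.
Qed.

End rate.

Section limits.
Context {R : realType} {n : nat}.
Implicit Types (sigma zeta : nat -> R) (x : nat -> 'cV[R]_n).

Lemma penalty_limits sigma (sigma_oo : \bar R) (kappa : R) :
  0 <= kappa -> (forall k, 0 < sigma 0%N <= sigma k) ->
  (sigma k)%:E @[k --> \oo] --> sigma_oo ->
  (sigma k)^-1 @[k --> \oo] --> (if sigma_oo is r%:E then r^-1 else 0) /\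
  kappa / Num.sqrt (kappa ^+ 2 + sigma k ^+ 2) @[k --> \oo] -->
    (if sigma_oo is r%:E then kappa / Num.sqrt (kappa ^+ 2 + r ^+ 2) else 0).
Proof.
move=> k0 s0.
have spos k : 0 < sigma k by have /andP[/lt_le_trans] := s0 k; apply.
case: sigma_oo => [r| |] sigma_cvg.
- have {}sigma_cvg : sigma k @[k --> \oo] --> r by exact: (fine_cvg sigma_cvg).
  have r0 : 0 < r.
    have /andP[+ _] := s0 0%N; move=> /lt_le_trans; apply.
    apply: (@ler_cvg_to _ \oo _ _ (fun=> sigma 0%N) sigma) => //.
      exact: cvg_cst.
    by near=> k; have /andP[] := s0 k.
  split; first by apply: cvgV; rewrite ?gt_eqF.
  apply: cvgMr; apply: cvgV.
    by rewrite gt_eqF// sqrtr_gt0 ltr_wpDl ?sqr_ge0 ?exprn_gt0.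
  have sum_cvg : kappa ^+ 2 + sigma k ^+ 2 @[k --> \oo] --> kappa ^+ 2 + r ^+ 2.
    by apply: cvgD; [exact: cvg_cst|exact: cvgM].
  exact: (cvg_comp _ _ sum_cvg (@sqrt_continuous _ _)).
- have {}sigma_cvg : sigma k @[k --> \oo] --> +oo by exact/cvgeryP.
  have inv0 : (sigma k)^-1 @[k --> \oo] --> 0.
    by apply/gtr0_cvgV0 => //; near=> k.
  split=> //.
  apply: (@squeeze_cvgr _ _ _ _ (fun=> 0) (fun k => kappa * (sigma k)^-1)).
  + near=> k; rewrite divr_ge0 ?sqrtr_ge0//= ler_wpM2l// lef_pV2 ?posrE//.
      by rewrite -{1}(ger0_norm (ltW (spos k))) -sqrtr_sqr ler_wsqrtr// lerDr sqr_ge0.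
    by rewrite sqrtr_gt0 ltr_wpDl ?sqr_ge0 ?exprn_gt0.
  + exact: cvg_cst.
  + by rewrite -[X in _ --> X](mulr0 kappa); exact: cvgMr.
- exfalso; move/cvgeNyPle : sigma_cvg => /(_ 0)[N _ /(_ N (leqnn N))].
  by rewrite /= lee_fin leNgt spos.
Unshelve. all: by end_near. Qed.

Lemma rate_limits (th iota zeta : nat -> R) x (th_oo iota_oo : R) x_oo :
  th k @[k --> \oo] --> th_oo -> iota k @[k --> \oo] --> iota_oo ->
  zeta k @[k --> \oo] --> 0 -> x k @[k --> \oo] --> x_oo ->
  [/\ (th k + 2 * zeta k) * (1 - zeta k)^-1 @[k --> \oo] --> th_oo,
      iota k * (1 - zeta k)^-1 @[k --> \oo] --> iota_oo &
      iota k * (1 - zeta k)^-1 * (zeta k ^+ 2 * enorm (x k.+1 - x k)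
        + enorm (x k.+1) + enorm (x k)) / 2 @[k --> \oo]
        --> enorm x_oo * iota_oo].
Proof.
move=> th_cvg iota_cvg zeta_cvg x_cvg.
have inv1 : (1 - zeta k)^-1 @[k --> \oo] --> (1 : R).
  rewrite -[X in _ --> X]invr1; apply: cvgV; first exact: oner_neq0.
  by rewrite -[X in _ --> X]subr0; apply: cvgB => //; exact: cvg_cst.
have vsig_cvg : iota k * (1 - zeta k)^-1 @[k --> \oo] --> iota_oo.
  by rewrite -[X in _ --> X]mulr1; exact: cvgM.
have xS_cvg : x k.+1 @[k --> \oo] --> x_oo by rewrite (cvg_shiftS x).
split=> //.
  rewrite -[X in _ --> X]mulr1; apply: cvgM => //.
  rewrite -[X in _ --> X]addr0; apply: cvgD => //.
  by rewrite -[X in _ --> X](mulr0 2); exact: cvgMr.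
have -> : enorm x_oo * iota_oo
    = iota_oo * (0 ^+ 2 * enorm (x_oo - x_oo) + enorm x_oo + enorm x_oo) / 2.
  by field.
apply: cvgMl; apply: cvgM => //.
apply: cvgD; last exact: cvg_enorm.
apply: cvgD; last exact: cvg_enorm.
apply: cvgM; first by rewrite !expr2; exact: cvgM.
by apply: cvg_enorm; exact: cvgB.
Qed.

End limits.

Theorem theorem3 (R : realType) (m n s : nat)
    (A : 'M[R]_(m, n)) (B : 'M[R]_(s, n)) (d : 'cV[R]_s)
    (h : 'cV[R]_m -> \bar R) (p : 'cV[R]_n -> \bar R)
    (z : nat -> @dual_space R m n s) (x : nat -> 'cV[R]_n)
    (sigma : nat -> R) (sigma_oo : \bar R) (zeta : nat -> R)
    (x_oo : 'cV[R]_n) (kappa : R)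
    (rho := fun k =>
      (kappa / Num.sqrt (kappa ^+ 2 + sigma k ^+ 2) + 2 * zeta k)
        * (1 - zeta k)^-1)
    (vsig := fun k => (sigma k)^-1 * (1 - zeta k)^-1)
    (vsig' := fun k =>
      vsig k * (zeta k ^+ 2 * enorm (x k.+1 - x k)
                + enorm (x k.+1) + enorm (x k)) / 2)
    (Sol := inverse_image (T_phi A B d h p) 0) :
  closed_proper_convex h ->
  continuously_differentiable_on_dom h ->
  closed_proper_convex p ->
  alm_sequence A B z x sigma sigma_oo ->
  stopping_criterion_B A B d h p z x sigma zeta ->
  x k @[k --> \oo] --> x_oo ->
  Sol x_oo ->
  metrically_subregular (T_phi A B d h p) x_oo 0 kappa ->
  (\forall k \near \oo,
    [/\ (dist (x k.+1) Sol <= (rho k)%:E * dist (x k) Sol)%E,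
        ((enorm (dual_residual A B (z k.+1)))%:E
           <= (vsig k)%:E * dist (x k) Sol)%E,
        (dual_obj d h p (z k.+1) - dual_value A B d h p
           <= (vsig' k)%:E * dist (x k) Sol)%E &
        rho k < 1]) /\
  [/\ rho k @[k --> \oo] -->
        (if sigma_oo is r%:E then kappa / Num.sqrt (kappa ^+ 2 + r ^+ 2)
         else 0),
      vsig k @[k --> \oo] --> (if sigma_oo is r%:E then r^-1 else 0) &
      vsig' k @[k --> \oo] -->
        (if sigma_oo is r%:E then enorm x_oo / r else 0)].
Proof.
move=> [_ hprop _] _ [_ pprop _] [s00 sigma_nd sigma_cvg xS] [z0 zeta_sum crit].
move=> x_cvg Sol_oo [k0 _ [E1 [E2 [E1nbhs E2nbhs subreg]]]].
have sigma_ge k : 0 < sigma 0%N <= sigma k.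
  by rewrite s00/=; elim: k => // k /le_trans; apply; exact: sigma_nd.
have spos k : 0 < sigma k by have /andP[/lt_le_trans] := sigma_ge k; apply.
have zeta_cvg : zeta k @[k --> \oo] --> 0.
  by apply: cvg_series_cvg_0; exact: nnseries_is_cvg.
have [inv_cvg th_cvg] := penalty_limits k0 sigma_ge sigma_cvg.
split; last first.
  have [rho_cvg vsig_cvg vsig'_cvg] :=
    rate_limits th_cvg inv_cvg zeta_cvg x_cvg.
  split=> //.
  by move: vsig'_cvg; case: (sigma_oo) => [r| |]//; rewrite mulr0.
have Sol0 : Sol !=set0 by exists x_oo.
have fin_oo : phi A B d h p x_oo \is a fin_num by case: Sol_oo.
have [e1 e10 E1ball] := near_enorm E1nbhs.
have [e2 e20 E2ball] := near_enorm E2nbhs.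
have err_cvg : enorm (x k - x_oo) @[k --> \oo] --> 0.
  rewrite -[X in _ --> X](@enorm0 R n) -(subrr x_oo).
  by apply: cvg_enorm; apply: cvgB => //; exact: cvg_cst.
pose th k := kappa / Num.sqrt (kappa ^+ 2 + sigma k ^+ 2).
have norm_gt0 k : 0 < Num.sqrt (kappa ^+ 2 + sigma k ^+ 2).
  by rewrite sqrtr_gt0 ltr_wpDl ?sqr_ge0 ?exprn_gt0.
(* As sigma is nondecreasing, the exact factors stay below th 0 < 1. *)
have th0_lt1 : th 0%N < 1.
  rewrite ltr_pdivrMr// mul1r -{1}[kappa]ger0_norm// -sqrtr_sqr ltr_sqrt.
    by rewrite ltrDl exprn_gt0.
  by rewrite ltr_wpDl ?sqr_ge0 ?exprn_gt0.
have th_le k : th k <= th 0%N.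
  rewrite ler_wpM2l// lef_pV2 ?posrE// ler_wsqrtr// lerD2l.
  by rewrite ler_pXn2r ?nnegrE ?(ltW (spos _))//; have /andP[] := sigma_ge k.
near=> k.
have err1 : enorm (x k - x_oo) < e1 by near: k; exact: (cvgr_lt 0).
have err2 : enorm (x k - x_oo) < e2 * sigma 0%N.
  by near: k; apply: (cvgr_lt 0) => //; exact: mulr_gt0.
(* The constant 3 ensures th k + 2 zeta k < 1 - zeta k, that is rho k < 1. *)
have zeta_small : zeta k < (1 - th 0%N) / 3.
  by near: k; apply: (cvgr_lt 0) => //; rewrite divr_gt0 ?subr_gt0.
have th0 : 0 <= th k by rewrite divr_ge0// ltW.
have zk : 0 <= zeta k < 1.
  by rewrite z0/=; have := th_le k; lra.
have [[rbar [Ty inexact]] gap] :=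
  inexact_step hprop pprop (spos k) (z0 k) fin_oo (xS k) (crit k).
set y := x k - sigma k *: rbar in Ty inexact.
have xy : x k - y = sigma k *: rbar by rewrite /y opprB addrC subrK.
have pyth xhat : Sol xhat ->
    enorm (x k - y) ^+ 2 + enorm (y - xhat) ^+ 2 <= enorm (x k - xhat) ^+ 2.
  by move=> Sx; rewrite xy; exact: (proximal_pythagoras (spos k) Sx Ty).
have yE1 : E1 y.
  apply: E1ball; apply: le_lt_trans err1.
  rewrite -(@ler_pXn2r _ 2) ?nnegrE ?enorm_ge0//.
  by apply: le_trans (pyth _ Sol_oo); rewrite lerDr sqr_ge0.
(* sigma 0 |rbar| <= sigma k |rbar| = |x k - y| <= |x k - x_oo|. *)
have rbarE2 : E2 (- rbar).
  apply: E2ball; rewrite subr0 enormN -(ltr_pM2r s00).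
  apply: le_lt_trans err2.
  apply: (@le_trans _ _ (enorm (x k - y))).
    rewrite xy (enormZ _ (ltW (spos k))) mulrC ler_wpM2r ?enorm_ge0//.
    by have /andP[] := sigma_ge k.
  rewrite -(@ler_pXn2r _ 2) ?nnegrE ?enorm_ge0//.
  by apply: le_trans (pyth _ Sol_oo); rewrite lerDl sqr_ge0.
have disty : (dist y Sol <= (kappa * (enorm (x k - y) / sigma k))%:E)%E.
  apply: (le_trans (subreg y yE1 _)); first by exists (- rbar).
  rewrite EFinM lee_wpmul2l ?lee_fin//.
  apply: ereal_inf_lbound; exists (- rbar) => //.
  by rewrite opprK add0r xy (enormZ _ (ltW (spos k))) mulrC mulKf// gt_eqF.
have [step contr] :=
  contraction_estimates (spos k) zk k0 Sol0 pyth disty inexact.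
have [D DE _] := dist_finE (x k) Sol0; rewrite DE in step contr *.
move: step; rewrite -EFinM lee_fin => step.
split=> //.
- rewrite -EFinM lee_fin /vsig -mulrA mulrC ler_pdivlMr//.
  apply: le_trans step; rewrite enorm_distC xS opprB addrC subrK.
  by rewrite (enormZ _ (ltW (spos k))) mulrC.
- apply: le_trans gap _; rewrite -EFinM lee_fin /vsig' /vsig.
  set K := (_ + _ + _); have K0 : 0 <= K.
    by rewrite !addr_ge0 ?mulr_ge0 ?sqr_ge0 ?enorm_ge0.
  have -> : (sigma k)^-1 * (1 - zeta k)^-1 * K / 2 * D =
      (1 - zeta k)^-1 * D / (2 * sigma k) * K.
    by rewrite invfM; ring.
  by rewrite ler_wpM2r// ler_wpM2r// invr_ge0 ltW// mulr_gt0.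
- have /andP[_ z1] := zk.
  rewrite /rho -/(th k) ltr_pdivrMr ?subr_gt0// mul1r.
  by have := th_le k; lra.
Unshelve. all: by end_near. Qed.
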